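(* Let $P$ be an $n\times n$ sign pattern with fixed periphery. Then $M^{\mathbb{R}}(P) \leq Z_{\pm}(P)$, where $M^{\mathbb{R}}(P)$ is the maximum nullity of a real $n\times n$ matrix with sign pattern $P$ and $Z_{\pm}(P)$ is the signed zero forcing number of $P$.
   Context: A sign pattern is an $n\times n$ array $P$ with entries in $\{+,-,0,?\}$; its vertices are the indices $1,\dots,n$. A real matrix $A$ has sign pattern $P$ if $\operatorname{sign}(A_{ij})=P_{ij}$ whenever $P_{ij}\neq ?$ (no restriction on $A_{ij}$ when $P_{ij}=?$). $P$ has fixed periphery if $P_{ij}\neq ?$ for all $i\neq j$. $M^{\mathbb{R}}(P)$ is the maximum of $\dim\ker A$ over real (not necessarily symmetric) matrices $A$ with sign pattern $P$. Signed zero forcing game on $P$: each vertex is black or white; a white vertex may additionally carry a marker $m(w)\in\{+,-\}$ (write $m(w)=*$ if unmarked; a marker disappears when its vertex is colored black). Initially a set $S$ of vertices is colored black, all others white and unmarked. Write $\iota(+)=-$, $\iota(-)=+$, and for $s,t\in\{+,-\}$ let $s\cdot t=+$ if $s=t$ and $-$ otherwise. A move is an application of the following rule. Let $u$ be a vertex that is either black, or white with $P_{uu}\neq ?$. Let $W$ be the set of white vertices $w$ (possibly $w=u$) with $P_{uw}\in\{+,-\}$. Let $W_+=\{w\in W: m(w)=P_{uw}\}$, $W_-=\{w\in W: m(w)\neq *,\ m(w)\neq P_{uw}\}$, $W_*=\{w\in W: m(w)=*\}$. (a) If $W=\{w\}$, color $w$ black. (b) If $W_+=W$ or $W_-=W$,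 color all vertices of $W$ black. (c) If for some $s\in\{+,-\}$ we have $W_s\neq\emptyset$, $W_{\iota(s)}=\emptyset$ and $W_*=\{w\}$, mark $w$ with $P_{uw}\cdot\iota(s)$. (d) (Seeding) If no white vertex of $P$ currently carries a marker, any white vertex may be marked with $+$. $S$ is a signed zero forcing set if some sequence of moves makes all vertices black; $Z_{\pm}(P)$ is the minimum size of a signed zero forcing set. *)

(* Defs.v *)
From Stdlib Require Import Relation_Operators.
From mathcomp Require Import all_boot all_order all_algebra.
From mathcomp Require Import boolp reals.

Set Implicit Arguments.
Unset Strict Implicit.
Unset Printing Implicit Defensive.

Import Order.TTheory GRing.Theory Num.Theory.
Local Open Scope ring_scope.

(** The signs + and - are the booleans [true] and [false]: iota is [negb]. *)
Definition sign_mul (s t : bool) : bool := s == t.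

Variant entry := Signed of bool | Zero | Unknown.

Definition sign_pattern (n : nat) := 'M[entry]_n.

Definition fixed_periphery n (P : sign_pattern n) : Prop :=
  forall i j : 'I_n, i != j -> P i j <> Unknown.

Definition sign_of (R : realType) (x : R) : entry :=
  if 0 < x then Signed true else if x < 0 then Signed false else Zero.

Definition has_sign_pattern (R : realType) n (A : 'M[R]_n)
    (P : sign_pattern n) : Prop :=
  forall i j : 'I_n, P i j <> Unknown -> sign_of (A i j) = P i j.

(** [kermx] is a left kernel; the row space of [kermx A^T] consists of the
    transposes of the column vectors [x] such that [A *m x = 0]. *)
Definition nullity (R : realType) n (A : 'M[R]_n) : nat := \rank (kermx A^T).

(** Nullities of n x n matrices are at most n, so the maximum ranges over
    0, ..., n; see [nullity_le_max] and [max_nullity_attained]. *)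
Definition max_nullity (R : realType) n (P : sign_pattern n) : nat :=
  (\max_(k < n.+1 |
     `[< exists A : 'M[R]_n, has_sign_pattern A P /\ nullity A = k >]) k)%N.

Variant vertex_state := Black | White of option bool.

Definition state (n : nat) := {ffun 'I_n -> vertex_state}.

Definition is_white (v : vertex_state) : bool :=
  if v is White _ then true else false.

Definition marker (v : vertex_state) : option bool :=
  if v is White m then m else None.

Definition entry_sign (e : entry) : option bool :=
  if e is Signed s then Some s else None.

Section Game.
Variables (n : nat) (P : sign_pattern n).
Implicit Types (st : state n) (u v w : 'I_n) (s t : bool) (S : {set 'I_n}).

Definition may_act st u : Prop := ~~ is_white (st u) \/ P u u <> Unknown.

Definition W st u : {set 'I_n} :=
  [set w | is_white (st w) & entry_sign (P u w) != None].

(** [W_ st u true] is W_+ and [W_ st u false] is W_-. *)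
Definition W_ st u s : {set 'I_n} :=
  [set w in W st u | (marker (st w) != None) &
                     ((marker (st w) == entry_sign (P u w)) == s)].

Definition W_unmarked st u : {set 'I_n} :=
  [set w in W st u | marker (st w) == None].

Definition blacken st S : state n :=
  [ffun v => if v \in S then Black else st v].

Definition mark st w s : state n :=
  [ffun v => if v == w then White (Some s) else st v].

Inductive move st : state n -> Prop :=
| move_single u w :
    may_act st u -> W st u = [set w] -> move st (blacken st [set w])
| move_same_sign u s :
    may_act st u -> W_ st u s = W st u -> move st (blacken st (W st u))
| move_mark u s w t :
    may_act st u ->
    W_ st u s != set0 -> W_ st u (~~ s) = set0 -> W_unmarked st u = [set w] ->
    P u w = Signed t -> move st (mark st w (sign_mul t (~~ s)))
| move_seed w :
    (forall v, marker (st v) = None) -> is_white (st w) ->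
    move st (mark st w true).

Definition initial_state S : state n :=
  [ffun v => if v \in S then Black else White None].

Definition signed_zero_forcing S : Prop :=
  exists st, clos_refl_trans_1n (state n) move (initial_state S) st /\
             forall v, st v = Black.

(** The default [setT] is signed zero forcing, with no move; see
    [signed_zero_forcing_setT]. *)
Definition Zpm : nat :=
  #|[arg min_(S < [set: 'I_n] | `[< signed_zero_forcing S >]) #|S|]|.

Lemma signed_zero_forcing_setT : signed_zero_forcing [set: 'I_n].
Proof.
exists (initial_state [set: 'I_n]); split; first exact: rt1n_refl.
by move=> v; rewrite ffunE in_setT.
Qed.

Lemma Zpm_attained : exists2 S, signed_zero_forcing S & #|S| = Zpm.
Proof.
rewrite /Zpm; case: arg_minnP => [|S /asboolP HS _]; last by exists S.
exact/asboolP/signed_zero_forcing_setT.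
Qed.

Lemma Zpm_le S : signed_zero_forcing S -> (Zpm <= #|S|)%N.
Proof.
rewrite /Zpm => HS; case: arg_minnP => [|T _]; last by apply; apply/asboolP.
exact/asboolP/signed_zero_forcing_setT.
Qed.

Lemma nullity_le_max (R : realType) (A : 'M[R]_n) :
  has_sign_pattern A P -> (nullity A <= max_nullity R P)%N.
Proof.
move=> HA; have lt : (nullity A < n.+1)%N by rewrite ltnS rank_leq_col.
apply: (@leq_bigmax_cond _ _ (fun k : 'I_n.+1 => nat_of_ord k) (Ordinal lt)).
by apply/asboolP; exists A.
Qed.

Lemma max_nullity_attained (R : realType) :
  exists2 A : 'M[R]_n, has_sign_pattern A P & nullity A = max_nullity R P.
Proof.
pose A : 'M[R]_n := \matrix_(i, j)
  match P i j with Signed true => 1 | Signed false => -1 | _ => 0 end.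
have HA : has_sign_pattern A P.
  move=> i j; rewrite /sign_of mxE.
  by case: (P i j) => [[]||] // _; rewrite ?ltr01 ?oppr_gt0 ?ltr10 ?oppr_lt0
     ?ltr01 ?ltxx.
have lt : (nullity A < n.+1)%N by rewrite ltnS rank_leq_col.
rewrite /max_nullity.
have /eq_bigmax_cond : (0 < #|[pred k : 'I_n.+1 | `[< exists B : 'M[R]_n,
    has_sign_pattern B P /\ nullity B = k >]]|)%N.
  by apply/card_gt0P; exists (Ordinal lt); apply/asboolP; exists A.
by move=> /(_ (fun k => k)) [k /asboolP[B [HB Bk]] ->]; exists B.
Qed.

End Game.

(* Main.v *)
Require Import Defs.
From Stdlib Require Import Relation_Operators.
From mathcomp Require Import all_boot all_order all_algebra.
From mathcomp Require Import reals.

Set Implicit Arguments.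
Unset Strict Implicit.
Unset Printing Implicit Defensive.

Import Order.TTheory GRing.Theory Num.Theory.
Local Open Scope ring_scope.

(** Let [x] be in the kernel of [A] and vanish on a signed zero forcing set.
    Every move preserves the following property, possibly after replacing [x]
    by [- x]: black vertices carry the value 0, and the value at a marked vertex
    is zero or has the sign of the marker. A seeding move is the choice between
    [x] and [- x]; the other moves read off row [u] of [A *m x = 0], whose only
    possibly nonzero terms are those indexed by [W], all with entries of known
    sign. Hence [x = 0], so restricting kernel vectors to the forcing set is
    injective. *)

Section Signs.
Variable R : realType.

Definition sg (s : bool) : R := if s then 1 else -1.

Lemma sgN s : sg (~~ s) = - sg s.
Proof. by case: s; rewrite /= ?opprK. Qed.

Lemma sgM s t : sg (sign_mul s t) = sg s * sg t.
Proof. by case: s t => [] [] /=; rewrite ?mulr1 ?mul1r ?mulrNN ?mulr1. Qed.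

Lemma sg_sqr s : sg s * sg s = 1.
Proof. by case: s; rewrite /= ?mulrNN mulr1. Qed.

Lemma sg_neq0 s : sg s != 0.
Proof. by case: s; rewrite /= ?oppr_eq0 oner_eq0. Qed.

Lemma sign_of_Signed (a : R) t : sign_of a = Signed t -> 0 < sg t * a.
Proof.
rewrite /sign_of; case: ifP => [a_gt0 [<-]|_]; first by rewrite mul1r.
by case: ifP => // a_lt0 [<-]; rewrite mulN1r oppr_gt0.
Qed.

Lemma sign_of_Zero (a : R) : sign_of a = Zero -> a = 0.
Proof. by rewrite /sign_of; case: ltgtP. Qed.

End Signs.

(** A basis of the kernel, cut down to the coordinates in [S], still has independent rows: a
    combination vanishing on [S] is a kernel vector, hence zero. The number of rows is therefore at
    most the number [#|S|] of columns. *)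
Lemma rank_kermx_le_card (F : fieldType) (n : nat) (A : 'M[F]_n)
    (S : {set 'I_n}) :
  (forall x : 'cV_n, A *m x = 0 -> (forall v, v \in S -> x v 0 = 0) -> x = 0) ->
  (\rank (kermx A^T) <= #|S|)%N.
Proof.
move=> kerA_S.
pose K := row_base (kermx A^T).
pose KS : 'M_(_, #|S|) := colsub enum_val K.
suff /eqP <- : row_free KS by rewrite rank_leq_col.
apply: inj_row_free => c cKS0.
suff cK0 : (c *m K)^T = 0.
  apply/eqP; rewrite -(mulmx_free_eq0 _ (row_base_free (kermx A^T))).
  by rewrite -trmx_eq0 cK0.
apply: kerA_S => [|v vS].
  apply: trmx_inj; rewrite trmx_mul trmxK trmx0; apply/sub_kermxP.
  by rewrite (submx_trans (submxMl _ _)) // eq_row_base.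
have := congr1 (fun y : 'rV__ => y 0 (enum_rank_in vS v)) cKS0.
rewrite !mxE => cKS0v; rewrite -[RHS]cKS0v; apply: eq_bigr => i _.
by rewrite [in RHS]mxE enum_rankK_in.
Qed.

Section Invariant.
Variables (R : realType) (n : nat) (P : sign_pattern n) (A : 'M[R]_n).
Hypotheses (fixP : fixed_periphery P) (patA : has_sign_pattern A P).
Implicit Types (st : state n) (x : 'cV[R]_n) (u v w : 'I_n).

Definition compatible st x : Prop := forall v,
  match st v with
  | Black => x v 0 = 0
  | White None => True
  | White (Some m) => 0 <= sg R m * x v 0
  end.

Lemma entry_W_gt0 st u w :
  w \in W P st u -> exists2 t, P u w = Signed t & 0 < sg R t * A u w.
Proof.
rewrite inE => /andP[_]; case Puw: (P u w) => [t||] // _.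
by exists t => //; apply: sign_of_Signed; rewrite patA Puw.
Qed.

Lemma term_W_eq0 st x u w :
  w \in W P st u -> A u w * x w 0 = 0 -> x w 0 = 0.
Proof.
move=> /entry_W_gt0[t _ sA_gt0] /eqP; rewrite mulf_eq0 => /orP[/eqP A0|/eqP//].
by rewrite A0 mulr0 ltxx in sA_gt0.
Qed.

(** Outside [W], either the vertex is black and [x] vanishes there, or the entry is [Zero]. An
    [Unknown] entry at a white vertex must be diagonal by [fixP], and [may_act] rules that out. *)
Lemma row_sum_W st x u : may_act P st u -> compatible st x -> A *m x = 0 ->
  \sum_(w in W P st u) A u w * x w 0 = 0.
Proof.
move=> act cx /(congr1 (fun y : 'cV_n => y u 0)); rewrite !mxE => Ax0.
rewrite -[RHS]Ax0 [RHS](bigID (mem (W P st u))) /= [X in _ + X]big1 ?addr0 //.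
move=> w; rewrite inE negb_and.
have := cx w; case stw: (st w) => [|m] /=; first by move=> ->; rewrite mulr0.
move=> _; case Puw: (P u w) => [t||] //= _.
  by rewrite (@sign_of_Zero _ (A u w)) ?mul0r // patA Puw.
case: (eqVneq u w) => [uw|/fixP]; last by rewrite Puw.
by move: act; rewrite /may_act -uw in Puw stw *; rewrite stw Puw => -[].
Qed.

Lemma term_W_signed st x u w s : compatible st x -> w \in W_ P st u s ->
  0 <= sg R s * (A u w * x w 0).
Proof.
move=> cx; rewrite inE => /and3P[wW].
have [t -> sA_gt0] := entry_W_gt0 wW.
have := cx w; case: (st w) => [|[m|]] //= sx_ge0 _ /eqP <-.
(* The index [s] is the product of the entry sign and the marker sign. *)
have -> : (Some m == Some t) = sign_mul t m by rewrite /sign_mul eq_sym.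
by rewrite sgM mulrACA mulr_ge0 // ltW.
Qed.

Lemma compatible_blacken st x (S : {set 'I_n}) :
  compatible st x -> (forall v, v \in S -> x v 0 = 0) ->
  compatible (blacken st S) x.
Proof.
by move=> cx xS v; rewrite ffunE; case: ifP => [/xS|_] //; exact: cx.
Qed.

Lemma compatible_mark st x w s : compatible st x -> 0 <= sg R s * x w 0 ->
  compatible (mark st w s) x.
Proof. by move=> cx sx v; rewrite ffunE; case: eqP => [->|_] //; exact: cx. Qed.

Lemma compatible_move st st' x : A *m x = 0 -> move P st st' ->
  compatible st x -> compatible st' x \/ compatible st' (- x).
Proof.
move=> Ax0
  [u w act Ww | u s act Ws | u s w t act _ WNs Wnone Puw | w nomark _] cx.
- left; apply: compatible_blacken => // v /set1P->.
  apply: (@term_W_eq0 st _ u); first by rewrite Ww set11.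
  by have := row_sum_W act cx Ax0; rewrite Ww big_set1.
- left; apply: compatible_blacken => // v vW.
  apply: (term_W_eq0 vW); apply: (mulfI (sg_neq0 R s)); rewrite mulr0.
  (* After scaling by [sg R s] all terms are nonnegative and sum to zero, so each is zero. *)
  apply: (psumr_eq0P (P := mem (W P st u))
    (F := fun w => sg R s * (A u w * x w 0))) => // [w wW|].
    by apply: (term_W_signed cx); rewrite Ws.
  by rewrite -big_distrr /= row_sum_W ?mulr0.
- left; apply: compatible_mark => //.
  have wW : w \in W P st u.
    by have := set11 w; rewrite -Wnone inE => /andP[].
  have [t' Puw' sA_gt0] := entry_W_gt0 wW.
  move: Puw'; rewrite Puw => -[tt']; rewrite -{t'}tt' in sA_gt0.
  (* Multiplying by the positive [sg R t * A u w] squares [sg R t] away; what remains is that the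
     row term at [w] is zero or has sign [~~ s]. *)
  rewrite -(pmulr_rge0 _ sA_gt0) sgM sgN mulrACA.
  rewrite [sg R t * (_ * _)]mulrA sg_sqr mul1r.
  have /eqP := row_sum_W act cx Ax0.
  rewrite (bigD1 w) //= addr_eq0 => /eqP rowE.
  rewrite rowE mulrNN mulr_sumr sumr_ge0 // => v /andP[vW v_neq_w].
  (* Being neither unmarked nor in [W_] for [~~ s], [v] lies in [W_] for [s]. *)
  apply: (term_W_signed cx); rewrite inE vW /=.
  have : v \notin W_unmarked P st u by rewrite Wnone inE.
  have : v \notin W_ P st u (~~ s) by rewrite WNs inE.
  rewrite [v \in W_ _ _ _ _]inE [v \in W_unmarked _ _ _]inE vW /= => /[swap] -> /=.
  by case: (_ == _) s {WNs rowE} => -[].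
(* Without markers, compatibility only asks for zeros at black vertices. *)
- have cNx : compatible st (- x).
    move=> v; have := cx v; have := nomark v.
    by case: (st v) => [_|[m|]] //= x0; rewrite mxE x0 oppr0.
  have [x_ge0|x_le0] := leP 0 (x w 0); [left|right];
    apply: compatible_mark => //; rewrite mul1r // mxE oppr_ge0; exact: ltW.
Qed.

(** Each seeding may flip the sign, so the induction ranges over all kernel vectors [x]; two flips
    cancel. *)
Lemma compatible_run st st' x : A *m x = 0 ->
  clos_refl_trans_1n (state n) (move P) st st' ->
  compatible st x -> compatible st' x \/ compatible st' (- x).
Proof.
move=> Ax0 run; elim: run x Ax0 => {st st'} [st|st1 st2 st3 step _ IH] x Ax0 cx.
  by left.
have ANx0 : A *m (- x) = 0 by rewrite mulmxN Ax0 oppr0.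
case: (compatible_move Ax0 step cx) => [/IH|/IH]; first exact.
by rewrite opprK => /(_ ANx0)[]; [right|left].
Qed.

Lemma signed_zero_forcing_ker_eq0 (S : {set 'I_n}) x :
  signed_zero_forcing P S -> A *m x = 0 -> (forall v, v \in S -> x v 0 = 0) ->
  x = 0.
Proof.
move=> [st [run black]] Ax0 xS.
have cx : compatible (initial_state S) x.
  by move=> v; rewrite ffunE; case: ifP => [/xS|].
by case: (compatible_run Ax0 run cx) => cst; apply/matrixP => v j;
   have := cst v; rewrite black ord1 !mxE // => /eqP; rewrite oppr_eq0 => /eqP.
Qed.

End Invariant.

Theorem mainTheorem1 (R : realType) (n : nat) (P : sign_pattern n)
  (hP : fixed_periphery P) : (max_nullity R P <= Zpm P)%N.
Proof.
have [A patA <-] := max_nullity_attained P R.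
have [S forceS <-] := Zpm_attained P.
by apply: rank_kermx_le_card => x; apply: signed_zero_forcing_ker_eq0 forceS.
Qed.
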